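(* Let $G$ be a meta-$\mathfrak{Nil}$-Hamiltonian group. If $G$ is soluble-by-finite, then $G$ is a $\mathcal{W}$-group.
   Context: A group $G$ is meta-$\mathfrak{Nil}$-Hamiltonian if every non-nilpotent subgroup of $G$ is normal in $G$. A group $G$ is a $\mathcal{W}$-group if every finitely generated non-nilpotent subgroup of $G$ has a finite non-nilpotent homomorphic image. $G$ is soluble-by-finite if it has a soluble normal subgroup of finite index. *)

(* Defs.v *)
From Stdlib Require Import List.

(* A group: carrier with multiplication, inverse, identity (left axioms suffice). *)
Record Group := {
  carrier :> Type;
  mul : carrier -> carrier -> carrier;
  inv : carrier -> carrier;
  one : carrier;
  mulA : forall x y z, mul x (mul y z) = mul (mul x y) z;
  mul1g : forall x, mul one x = x;
  mulVg : forall x, mul (inv x) x = one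
}.

Arguments mul {g}.
Arguments inv {g}.
Arguments one {g}.

Section Defs.
Variable G : Group.

Definition subset := G -> Prop.

Definition is_subgroup (H : subset) : Prop :=
  H one /\ (forall x y, H x -> H y -> H (mul x y)) /\ (forall x, H x -> H (inv x)).

Definition is_normal (H : subset) : Prop :=
  is_subgroup H /\ forall g h, H h -> H (mul (mul (inv g) h) g).

Inductive gen (A : subset) : subset :=
  | gen_in : forall a, A a -> gen A a
  | gen_one : gen A one
  | gen_mul : forall x y, gen A x -> gen A y -> gen A (mul x y)
  | gen_inv : forall x, gen A x -> gen A (inv x).

Definition comm (x y : G) : G := mul (mul (inv x) (inv y)) (mul x y).

Definition commSub (A B : subset) : subset :=
  gen (fun z => exists a b, A a /\ B b /\ z = comm a b).

Fixpoint lcs (H : subset) (n : nat) : subset :=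
  match n with
  | O => H
  | S m => commSub (lcs H m) H
  end.

Fixpoint der (H : subset) (n : nat) : subset :=
  match n with
  | O => H
  | S m => commSub (der H m) (der H m)
  end.

Definition trivial_sub (H : subset) : Prop := forall x, H x -> x = one.

Definition nilpotent (H : subset) : Prop := exists n, trivial_sub (lcs H n).
Definition soluble (H : subset) : Prop := exists n, trivial_sub (der H n).

Definition finite_index (S : subset) : Prop :=
  exists l : list G, forall x, exists g s, In g l /\ S s /\ x = mul g s.

Definition fin_gen (l : list G) : subset := gen (fun x => In x l).

End Defs.

Definition full (G : Group) : subset G := fun _ => True.

Definition finite_group (Q : Group) : Prop := exists l : list Q, forall q, In q l.

Definition hom_onto (G : Group) (H : subset G) (Q : Group) (f : G -> Q) : Prop :=
  (forall x y, H x -> H y -> f (mul x y) = mul (f x) (f y)) /\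
  (forall q, exists x, H x /\ f x = q).

Definition meta_Nil_Hamiltonian (G : Group) : Prop :=
  forall H : subset G, is_subgroup G H -> ~ nilpotent G H -> is_normal G H.

Definition soluble_by_finite (G : Group) : Prop :=
  exists S : subset G, is_normal G S /\ soluble G S /\ finite_index G S.

Definition W_group (G : Group) : Prop :=
  forall l : list G, ~ nilpotent G (fin_gen G l) ->
    exists (Q : Group) (f : G -> Q),
      finite_group Q /\ hom_onto G (fin_gen G l) Q f /\ ~ nilpotent Q (full Q).

(* Main.v *)
From HB Require Import structures.
From mathcomp Require Import all_boot all_order all_algebra.
From mathcomp Require Import boolp classical_sets.
From Stdlib Require List.
Require Import Defs.

(** Let [H] be a finitely generated non-nilpotent subgroup.  The terms of its
    lower central series are finitely generated as normal subgroups, so Zorn's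
    lemma gives [N] maximal among the normal subgroups of [H] with [H / N] not
    nilpotent.  Then [Q = H / N] is just-non-nilpotent with trivial center, and
    we show that it is finite.  If the soluble normal subgroup of finite index
    survives in [Q], its last nontrivial derived term [A] is abelian and normal.
    As [Q / C(A)] is nilpotent and nontrivial, some [y] outside [C(A)] is central
    modulo [C(A)]; it acts on [A] without fixed points, because [Z(Q) = 1].  So
    each [<y, b>] with [1 <> b] in [A] is non-nilpotent, hence normal in [Q],
    and this forces [A] to be a simple [Z[y, y^-1]]-module, hence finite.
    Finally [K = <y> A] is normal with trivial centralizer, since [Q] is
    just-non-nilpotent: [<y>] acts faithfully on [A], so [K] is finite, and [Q]
    acts faithfully on [K]. *)

Set Implicit Arguments.
Unset Strict Implicit.
Unset Printing Implicit Defensive.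
Import Order.TTheory GRing.Theory Num.Theory.

Local Open Scope ring_scope.

(** * Simple modules over the Laurent polynomials *)

(* Only [phi] is applied, not its inverse: [v] lies in the submodule generated
   by [b] under [phi] and its inverse when some [iter n phi v] is in the span. *)
Inductive cyclic_span (V : zmodType) (phi : V -> V) (b : V) : V -> Prop :=
| span_gen : cyclic_span phi b b
| span_sub u v : cyclic_span phi b u -> cyclic_span phi b v ->
    cyclic_span phi b (u - v)
| span_phi u : cyclic_span phi b u -> cyclic_span phi b (phi u).

Section SimpleModule.

Variables (V : zmodType) (phi psi : V -> V).
Hypothesis phiB : {morph phi : u v / u - v}.
Hypotheses (phiK : cancel phi psi) (psiK : cancel psi phi).
Hypothesis simpleV :
  forall a b : V, b != 0 -> exists n, cyclic_span phi b (iter n phi a).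

HB.instance Definition _ := GRing.isZmodMorphism.Build V V phi phiB.

Let phiMz v (c : int) : phi (v *~ c) = phi v *~ c.
Proof. exact: raddfMz. Qed.

Let phi0 : phi 0 = 0.
Proof. exact: raddf0. Qed.

Let iter_phiMz n v (c : int) : iter n phi (v *~ c) = iter n phi v *~ c.
Proof. by elim: n => //= n ->; rewrite phiMz. Qed.

Let psiMz v (c : int) : psi (v *~ c) = psi v *~ c.
Proof. by apply: (can_inj phiK); rewrite psiK phiMz psiK. Qed.

Let iter_phi_inj n : injective (iter n phi).
Proof. by elim: n => //= n IHn u v /(can_inj phiK) /IHn. Qed.

Let iter_psiK n v : iter n phi (iter n psi v) = v.
Proof. by elim: n => // n IHn; rewrite iterSr iterS psiK. Qed.

(** The elements killed by [c] form a subgroup stable under [phi], which therefore contains the span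
    of [b]; injectivity of [iter n phi] carries this back to [v]. *)
Lemma torsion_annihilates (b v : V) (c : int) : b != 0 -> b *~ c = 0 -> v *~ c = 0.
Proof.
move=> b0 bc; have [n] := simpleV v b0.
suff span0 u : cyclic_span phi b u -> u *~ c = 0.
  by move/span0; rewrite -iter_phiMz => e; apply: (@iter_phi_inj n);
     rewrite e; elim: n {e} => //= n <-; rewrite phi0.
elim=> [//|u1 u2 _ IH1 _ IH2|u1 _ IH]; first by rewrite mulrzBl IH1 IH2 subr0.
by rewrite -phiMz IH phi0.
Qed.

(** The multiples of [c] form a subgroup stable under [phi]; the quotient found for [iter n phi v]
    is carried back by [psi]. *)
Lemma divisible_by_nontorsion (b v : V) (c : int) :
  b *~ c != 0 -> exists w, v = w *~ c.
Proof.
move=> bc0; have [n] := simpleV v bc0.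
suff spanD u : cyclic_span phi (b *~ c) u -> exists w, u = w *~ c.
  move/spanD=> [w ew]; exists (iter n psi w); apply: (@iter_phi_inj n).
  by rewrite ew iter_phiMz iter_psiK.
elim=> [|_ _ _ [w1 ->] _ [w2 ->]|_ _ [w ->]]; first by exists b.
  by exists (w1 - w2); rewrite mulrzBl.
by exists (phi w); rewrite phiMz.
Qed.

(** * Polynomial relations on a nonzero element *)

Section Generator.

Variable a : V.
Hypothesis a0 : a != 0.

(** This is the operator [p(phi)] applied to [a]. *)
Definition peval (p : {poly int}) : V := \sum_(i < size p) iter i phi a *~ p`_i.

Lemma peval_widen n (p : {poly int}) : (size p <= n)%N ->
  peval p = \sum_(i < n) iter i phi a *~ p`_i.
Proof.
move=> le_n; rewrite /peval (big_ord_widen n (fun i => iter i phi a *~ p`_i)) //.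
rewrite big_mkcond /=; apply: eq_bigr => i _.
by case: ltnP => // le_i; rewrite nth_default ?mulr0z.
Qed.

Lemma pevalB : {morph peval : p q / p - q}.
Proof.
move=> p q; pose n := maxn (size p) (size q).
rewrite !(@peval_widen n) ?leq_maxl ?leq_maxr //; last first.
  by rewrite (leq_trans (size_polyD _ _)) // size_polyN.
by rewrite -sumrB; apply: eq_bigr => i _; rewrite coefB mulrzBr.
Qed.

HB.instance Definition _ := GRing.isZmodMorphism.Build {poly int} V peval pevalB.

Lemma pevalD : {morph peval : p q / p + q}.
Proof. exact: raddfD. Qed.

Lemma pevalZ (c : int) p : peval (c *: p) = peval p *~ c.
Proof.
rewrite (@peval_widen (size p)) ?size_scale_leq // /peval mulrz_suml.
by apply: eq_bigr => i _; rewrite coefZ mulrC mulrzA.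
Qed.

Lemma pevalXM p : peval (p * 'X) = phi (peval p).
Proof.
rewrite (@peval_widen (size p).+1); last first.
  by rewrite (leq_trans (size_polyMleq _ _)) // size_polyX addn2.
rewrite big_ord_recl coefMX mulr0z add0r [RHS]raddf_sum; apply: eq_bigr => i _.
by rewrite coefMX /= phiMz.
Qed.

Lemma pevalC c : peval c%:P = a *~ c.
Proof.
by rewrite (@peval_widen 1) ?size_polyC ?leq_b1 // big_ord1 coefC.
Qed.

Lemma pevalXn n : peval 'X^n = iter n phi a.
Proof.
elim: n => [|n IHn]; first by rewrite expr0 -[1]/(1%:P) pevalC.
by rewrite exprSr pevalXM IHn.
Qed.

(** The second clause asks [r] to be nonzero modulo the annihilator of [a] in the integers, so that
    a polynomial with all coefficients divisible by the order of [a] does not count. *)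
Definition relation r := peval r = 0 /\ exists i, a *~ r`_i != 0.

(* Writing [a] as a combination of translates of [a + phi a] gives a polynomial
   whose value at -1 is a unit, hence a nontrivial one. *)
Lemma relation_exists : exists r, relation r.
Proof.
have [w0|w0] := eqVneq (a + phi a) 0.
  exists (1 + 'X); split; last by exists 0%N; rewrite coefD coef1 coefX addr0.
  by rewrite pevalD -['X]expr1 pevalXn -(expr0 'X) pevalXn.
have [n] := simpleV a w0.
have spanP u : cyclic_span phi (a + phi a) u ->
    exists2 p, peval p = u & p.[-1] = 0.
  elim=> [|_ _ _ [p <- p0] _ [q <- q0]|_ _ [p <- p0]].
  - exists (1 + 'X); last by rewrite !hornerE subrr.
    by rewrite pevalD -['X]expr1 pevalXn -(expr0 'X) pevalXn.
  - by exists (p - q); rewrite ?pevalB // !hornerE p0 q0 subrr.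
  - by exists (p * 'X); rewrite ?pevalXM // !hornerE p0 mul0r.
case/spanP=> p ep p0; exists (p - 'X^n).
split; first by rewrite pevalB ep pevalXn subrr.
apply: contrapT => noi; case/eqP: a0.
have e1 : (p - 'X^n).[-1] * - (-1) ^+ n = 1.
  by rewrite !hornerE p0 sub0r mulrNN -exprMn mulrNN mulr1 expr1n.
rewrite -[LHS](mulr1z a) -e1 mulrzA horner_coef mulrz_sumr big1 ?mul0rz // => i _.
by rewrite mulrzA; have [->|ai] := eqVneq (a *~ (p - 'X^n)`_i) 0;
  [rewrite mul0rz | case: noi; exists i].
Qed.

Lemma minimal_relation_exists :
  exists2 r, relation r & forall s, relation s -> (size r <= size s)%N.
Proof.
pose P n := `[< exists2 r, relation r & size r = n >].
have exP : exists n, P n.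
  by have [r rr] := relation_exists; exists (size r); apply/asboolP; exists r.
case: (ex_minnP exP) => n /asboolP[r rr <-] rmin.
by exists r => // s rs; apply/rmin/asboolP; exists s.
Qed.

(** * Finiteness from a relation of minimal degree *)

Section MinimalRelation.

Variable r : {poly int}.
Hypotheses (rP : relation r) (rmin : forall s, relation s -> (size r <= size s)%N).

Let d := (size r).-1.

Let size_r : size r = d.+1.
Proof.
rewrite /d prednK // lt0n size_poly_eq0; apply/eqP => r0.
by case: rP => _ [i]; rewrite r0 coef0 mulr0z eqxx.
Qed.

(** If the constant coefficient kills [a], the rest is divisible by ['X], and injectivity of [phi]
    makes the quotient a shorter relation. *)
Let coef0_r : a *~ r`_0 != 0.
Proof.
apply/eqP => r00; have [er [i ri]] := rP.
case: i ri => [|i ri]; first by rewrite r00 eqxx.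
pose s := drop_poly 1 r.
have rE : r = (r`_0)%:P + s * 'X.
  rewrite -[LHS](poly_take_drop 1) expr1; congr (_ + _).
  by apply/polyP => -[|k]; rewrite coef_take_poly coefC.
have rs : relation s.
  split; last by exists i; rewrite coef_drop_poly addn1.
  apply: (can_inj phiK); rewrite phi0 -pevalXM -er [in RHS]rE pevalD pevalC.
  by rewrite r00 add0r.
by have := rmin rs; rewrite size_drop_poly size_r subn1 /= ltnn.
Qed.

(** If the leading coefficient kills [a], it kills all of [V], and truncation gives a shorter
    relation. *)
Let coefd_r : a *~ r`_d != 0.
Proof.
apply/eqP => rd0; have [er [i ri]] := rP.
pose s := take_poly d r.
have rE : r = s + r`_d *: 'X^d.
  apply/polyP => k; rewrite coefD coef_take_poly coefZ coefXn.
  case: ltngtP => [lt|gt|->]; rewrite ?mulr0 ?addr0 ?mulr1 ?add0r //.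
  by rewrite nth_default // size_r.
have rs : relation s.
  split.
    rewrite -er [in RHS]rE pevalD pevalZ pevalXn.
    by rewrite (torsion_annihilates _ a0 rd0) addr0.
  exists i; rewrite coef_take_poly; case: ltngtP => // [gt|e].
    by move: ri; rewrite nth_default ?size_r // mulr0z eqxx.
  by move: ri; rewrite e rd0 eqxx.
by have := rmin rs; rewrite size_r => /leq_trans/(_ (size_take_poly _ _)); rewrite ltnn.
Qed.

Let d_gt0 : (0 < d)%N.
Proof.
rewrite lt0n; apply/eqP => d0; have [er _] := rP.
move: coef0_r; rewrite -er (@peval_widen 1) ?size_r ?d0 // big_ord1 /=.
by rewrite eqxx.
Qed.

Definition low v := exists2 p : {poly int}, (size p <= d)%N & v = peval p.

(** Reducing by [r] requires multiplying by its leading or its constant coefficient; with the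
    product of both, [m phi] and [m psi] each preserve [low]. *)
Let m := r`_0 * r`_d.

Let m_nontorsion (b : V) : b != 0 -> b *~ m != 0.
Proof.
move=> b0; apply/eqP; rewrite /m mulrzA.
have [e _|bn0 e] := eqVneq (b *~ r`_0) 0.
  by move: coef0_r; rewrite (torsion_annihilates _ b0 e) eqxx.
by move: coefd_r; rewrite (torsion_annihilates _ bn0 e) eqxx.
Qed.

Lemma lowB u v : low u -> low v -> low (u - v).
Proof.
move=> [p sp ->] [q sq ->]; exists (p - q); rewrite ?pevalB //.
by rewrite (leq_trans (size_polyD _ _)) // size_polyN geq_max sp.
Qed.

Lemma lowMz u (c : int) : low u -> low (u *~ c).
Proof.
move=> [p sp ->]; exists (c *: p); rewrite ?pevalZ //.
exact: leq_trans (size_scale_leq _ _) sp.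
Qed.

Lemma low_phi u : low u -> low (phi u *~ m).
Proof.
move=> [p sp ->]; rewrite /m mulrC mulrzA; apply: lowMz.
(* Subtracting a multiple of [r] cancels the coefficient of degree [d], the only one that is too
   high. *)
exists (r`_d *: (p * 'X) - p`_d.-1 *: r); last first.
  by rewrite pevalB !pevalZ pevalXM rP.1 mul0rz subr0.
apply/leq_sizeP => j; rewrite leq_eqVlt => /orP[/eqP <-|dj].
  by rewrite coefB !coefZ coefMX gtn_eqF //= mulrC subrr.
rewrite coefB !coefZ coefMX [r`_j]nth_default ?size_r // mulr0 subr0.
case: j dj => // j dj.
by rewrite /= [p`_j]nth_default ?mulr0 // (leq_trans sp).
Qed.

Lemma low_psi u : low u -> low (psi u *~ m).
Proof.
move=> [p sp ->]; rewrite /m mulrzA; apply: lowMz.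
(* Here the constant coefficient is cancelled, so that division by ['X] computes [psi]. *)
pose q := r`_0 *: p - p`_0 *: r.
have q0 : q`_0 = 0 by rewrite coefB !coefZ mulrC subrr.
have qE : q = drop_poly 1 q * 'X.
  rewrite -[LHS](poly_take_drop 1) expr1 [take_poly 1 q](_ : _ = 0) ?add0r //.
  by apply/polyP => -[|k]; rewrite coef_take_poly coef0.
exists (drop_poly 1 q).
  rewrite size_drop_poly leq_subLR add1n (leq_trans (size_polyD _ _)) //.
  rewrite size_polyN geq_max (leq_trans (size_scale_leq _ _)) ?(leqW sp) //.
  by rewrite (leq_trans (size_scale_leq _ _)) ?size_r.
apply: (can_inj phiK); rewrite -pevalXM -qE phiMz psiK.
by rewrite pevalB !pevalZ rP.1 mul0rz subr0.
Qed.

(** Each [phi] used in the span costs one factor [m], and so does each [psi] bringing [iter n phi v]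
    back to [v]. *)
Lemma low_mul_eventually v : exists k, low (v *~ (m ^+ k)).
Proof.
have [n] := simpleV v a0.
have spanP u : cyclic_span phi a u -> exists k, low (u *~ (m ^+ k)).
  elim=> [|u1 u2 _ [k1 l1] _ [k2 l2]|u1 _ [k l]].
  - exists 0%N; exists 1; first by rewrite size_poly1.
    by rewrite -[1]/(1%:P) pevalC.
  - exists (k1 + k2)%N; rewrite mulrzBl exprD mulrzA [_ * _ ^+ k2]mulrC mulrzA.
    by apply: lowB; apply: lowMz.
  - by exists k.+1; rewrite exprSr mulrzA -phiMz; apply: low_phi.
move/spanP=> {spanP}; elim: n => //= n IHn [k l]; apply: IHn.
exists k.+1; rewrite exprSr mulrzA -[iter n phi v]phiK -psiMz; exact: low_psi.
Qed.

(** Otherwise take [p] prime to [m] and write [a] as [p] times [f]; some [m ^+ k] times [f] is the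
    value of a [q] of size at most [d]. Then [p *: q - m ^+ k] kills [a] but is too short to be a
    relation, so its constant coefficient vanishes and [p] divides [m ^+ k]. *)
Lemma simple_torsion : exists2 t, (0 < t)%N & a *+ t = 0.
Proof.
apply: contrapT => tf.
have tfz (c : int) : a *~ c = 0 -> c = 0.
  move=> ac; apply: contrapT => /eqP c0; apply: tf; exists `|c|%N.
    by rewrite absz_gt0.
  rewrite pmulrn abszE; case: (ger0P c) => _ //.
  by rewrite mulrNz ac oppr0.
(* This integer is prime to [m], and it exceeds 1 because [m] is nonzero. *)
pose p : int := m * m + 1.
have p2 : (1 < `|p|)%N.
  have m0 : m != 0.
    by apply/eqP => m0; have := m_nontorsion a0; rewrite m0 mulr0z eqxx.
  rewrite -ltz_nat gez0_abs ?addr_ge0 -?expr2 ?sqr_ge0 //.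
  by rewrite ltrDr /p -expr2 exprn_even_gt0.
have ap0 : a *~ p != 0.
  by apply/eqP => /tfz p0; rewrite p0 in p2.
have [f af] := divisible_by_nontorsion a ap0.
have [k [q sq fq]] := low_mul_eventually f.
pose s := p *: q - (m ^+ k)%:P.
have s0 : peval s = 0.
  by rewrite pevalB pevalZ -fq pevalC af -!mulrzA mulrC subrr.
have ss : (size s <= d)%N.
  rewrite (leq_trans (size_polyD _ _)) // size_polyN geq_max.
  rewrite (leq_trans (size_scale_leq _ _)) //=.
  by rewrite (leq_trans (size_polyC_leq1 _)).
have /tfz/eqP : a *~ s`_0 = 0.
  apply: contrapT => /eqP ns; have /rmin : relation s by split=> //; exists 0%N.
  by rewrite size_r => /leq_trans/(_ ss); rewrite ltnn.
rewrite coefB coefZ coefC /= subr_eq0 => /eqP e.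
have cop : coprimez p (m ^+ k).
  rewrite coprimezXr //; apply/coprimezP; exists (1, - m) => /=.
  by rewrite mul1r mulNr addrC addKr.
move: cop; rewrite -e /coprimez gcdzMr => /eqP /(congr1 absz) /=.
by move=> e1; move: p2; rewrite e1.
Qed.

(* Since [t] is minimal, [m] is prime to [t], so [V] is the [Z/t]-span of the
   [d] first translates of [a]. *)
Lemma simple_module_finite_of_relation : exists s : seq V, forall v, v \in s.
Proof.
pose P t := (0 < t)%N && (a *+ t == 0).
have exP : exists t, P t.
  by have [t t0 at0] := simple_torsion; exists t; rewrite /P t0 at0 eqxx.
case: (ex_minnP exP) => t /andP[t0 /eqP at0] tmin.
have cop : gcdz m t = 1.
  (* The element [b] is killed by [g]. If [b] is nonzero, then [g], and hence [m], kills [a], which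
     is excluded; if [b] is zero, minimality of [t] gives [g = 1]. *)
  pose g := gcdn `|m| t; have gt : (g %| t)%N := dvdn_gcdr _ _.
  have g0 : (0 < g)%N by rewrite gcdn_gt0 t0 orbT.
  pose b := a *+ (t %/ g).
  have bg : b *~ g = 0 by rewrite -pmulrn -mulrnA divnK.
  rewrite /gcdz -/g; have [b0|b0] := eqVneq b 0; last first.
    have /eqP[] := m_nontorsion a0.
    have /dvdzP[c ->] : (g %| m)%Z by rewrite dvdzE dvdn_gcdl.
    by rewrite mulrC mulrzA (torsion_annihilates _ b0 bg) mul0rz.
  have /tmin : P (t %/ g)%N by rewrite /P divn_gt0 // dvdn_leq //= -/b b0 eqxx.
  rewrite -{1}(divnK gt) => le1; congr (_%:Z); apply/eqP.
  rewrite eqn_leq g0 andbT -(@leq_pmul2l (t %/ g)) ?muln1 //.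
  by rewrite divn_gt0 // dvdn_leq.
have [u [w uw]] := Bezoutz m t; rewrite cop in uw.
have tV (v : V) : v *~ t = 0 by apply: (torsion_annihilates _ a0); rewrite -pmulrn.
(* By the Bezout relation [u] inverts [m] modulo [t], so the factor [m ^+ k] can be undone;
   coefficients are then reduced modulo [t]. *)
exists [seq \sum_(i < d) iter i phi a *+ f i
  | f : {ffun 'I_d -> 'I_t} <- enum {ffun 'I_d -> 'I_t}] => v.
have [k lk] := low_mul_eventually v.
have : low v.
  suff -> : v = v *~ (m ^+ k) *~ (u ^+ k) by apply: lowMz.
  have um (x : V) : x *~ m *~ u = x.
    have wt : x *~ (w * t) = 0 by rewrite mulrC mulrzA tV mul0rz.
    by rewrite -mulrzA mulrC -[RHS]mulr1z -uw mulrzDr wt addr0.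
  elim: k {lk} => // k IHk.
  by rewrite exprSr exprS mulrzA mulrzA um.
case=> q sq ->; rewrite (peval_widen sq).
have lt_t (c : int) : (`|(c %% t)%Z| < t)%N.
  have t0' : t%:Z != 0 by rewrite eqz_nat -lt0n.
  by rewrite -ltz_nat gez0_abs ?modz_ge0 // ltz_pmod.
apply/mapP; exists [ffun i : 'I_d => Ordinal (lt_t q`_i)]; rewrite ?mem_enum //.
apply: eq_bigr => i _; rewrite ffunE /= pmulrn gez0_abs; last first.
  by rewrite modz_ge0 // eqz_nat -lt0n.
by rewrite [in LHS](divz_eq q`_i t) mulrzDr mulrC mulrzA tV mul0rz add0r.
Qed.

End MinimalRelation.
End Generator.

Lemma simple_module_finite : exists s : seq V, forall v, v \in s.
Proof.
have [[a a0]|V0] := pselect (exists a : V, a != 0); last first.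
  exists [:: 0] => v; rewrite inE; apply/eqP; apply: contrapT => /eqP v0.
  by case: V0; exists v.
have [r rP rmin] := minimal_relation_exists a0.
exact: (simple_module_finite_of_relation a0 rP rmin).
Qed.

End SimpleModule.

Local Close Scope ring_scope.

Local Notation "x ∗ y" := (mul x y) (at level 40, left associativity).
Local Notation "x ⁻¹" := (inv x) (at level 3, left associativity, format "x ⁻¹").

(** * Groups and quotients *)

Section GroupLaws.

Variable G : Group.
Implicit Types x y z g h : G.

Lemma gmulgV x : x ∗ x⁻¹ = one.
Proof.
rewrite -[x ∗ _]mul1g -{1}(mulVg _ (x⁻¹)) -mulA (mulA _ _ x) mulVg mul1g.
by rewrite mulVg.
Qed.

Lemma gmulg1 x : x ∗ one = x.
Proof. by rewrite -(mulVg _ x) mulA gmulgV mul1g. Qed.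

Lemma gmulKg x y : x⁻¹ ∗ (x ∗ y) = y.
Proof. by rewrite mulA mulVg mul1g. Qed.

Lemma gmulVKg x y : x ∗ (x⁻¹ ∗ y) = y.
Proof. by rewrite mulA gmulgV mul1g. Qed.

Lemma gmulgI x y z : x ∗ y = x ∗ z -> y = z.
Proof. by move=> e; rewrite -(gmulKg x y) e gmulKg. Qed.

Lemma ginvK x : x⁻¹⁻¹ = x.
Proof. by apply: (@gmulgI x⁻¹); rewrite gmulgV mulVg. Qed.

Lemma ginv1 : one⁻¹ = one :> G.
Proof. by rewrite -[one⁻¹]mul1g gmulgV. Qed.

Lemma ginvM x y : (x ∗ y)⁻¹ = y⁻¹ ∗ x⁻¹.
Proof.
by apply: (@gmulgI (x ∗ y)); rewrite gmulgV -mulA gmulVKg gmulgV.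
Qed.

Lemma gmulAr x y z : x ∗ y ∗ z = x ∗ (y ∗ z).
Proof. by rewrite mulA. Qed.

Definition conj x g := g⁻¹ ∗ x ∗ g.

End GroupLaws.

(** These ten rules are the complete rewriting system for free groups: [group] brings both sides of
    an identity to reduced words. *)
Definition grpE G :=
  (@ginvM G, @ginvK G, @ginv1 G, mul1g G, @gmulg1 G, @gmulKg G, @gmulVKg G,
   mulVg G, @gmulgV G, @gmulAr G).

Ltac group := rewrite /comm /conj !grpE.

Section Conjugation.

Variable G : Group.
Implicit Types x y z g h : G.

Lemma conjM x y g : conj (x ∗ y) g = conj x g ∗ conj y g.
Proof. by group. Qed.

Lemma conjV x g : conj x⁻¹ g = (conj x g)⁻¹.
Proof. by group. Qed.

Lemma conj1g g : conj one g = one.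
Proof. by group. Qed.

Lemma conjg1 x : conj x one = x.
Proof. by group. Qed.

Lemma conjMr x g h : conj x (g ∗ h) = conj (conj x g) h.
Proof. by group. Qed.

Lemma conjK x g : conj (conj x g) g⁻¹ = x.
Proof. by group. Qed.

Lemma conjVK x g : conj (conj x g⁻¹) g = x.
Proof. by group. Qed.

Lemma conj_comm x y g : conj (comm G x y) g = comm G (conj x g) (conj y g).
Proof. by group. Qed.

Lemma commE x y : comm G x y = x⁻¹ ∗ conj x y.
Proof. by group. Qed.

Lemma conj_fixP x g : conj x g = x <-> x ∗ g = g ∗ x.
Proof.
split=> [e|e]; first by rewrite -{2}e; group.
by rewrite /conj gmulAr e gmulKg.
Qed.

Lemma comm1P x y : comm G x y = one -> conj x y = x.
Proof. by rewrite commE => e; apply: (@gmulgI _ x⁻¹); rewrite e mulVg. Qed.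

Lemma eq_mulV x y : x ∗ y⁻¹ = one -> x = y.
Proof. by move=> e; rewrite -(mul1g _ y) -e; group. Qed.

End Conjugation.

(** * Generated subgroups, commutator subgroups and centralizers *)

Section Subgroups.

Variable G : Group.
Implicit Types (x y z g h : G) (A B H M X : subset G).

Definition subset_of A B := forall x, A x -> B x.

Definition normalized H M := forall h x, H h -> M x -> M (conj x h).

Lemma is_normalP M :
  is_normal G M <-> is_subgroup G M /\ normalized (full G) M.
Proof.
split=> [[sM nM]|[sM nM]]; split=> //; first by move=> h x _; apply: nM.
by move=> g h Mh; apply: (nM g h).
Qed.

Lemma gen_subgroup A : is_subgroup G (gen G A).
Proof. by split; [apply: gen_one | split; [apply: gen_mul | apply: gen_inv]]. Qed.

Lemma gen_min A M : is_subgroup G M -> subset_of A M -> subset_of (gen G A) M.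
Proof.
case=> M1 [MM MV] AM x; elim=> [a /AM //|//|u v _ Mu _ Mv|u _ Mu].
  exact: MM.
exact: MV.
Qed.

Lemma genS A B : subset_of A B -> subset_of (gen G A) (gen G B).
Proof.
by move=> AB; apply: gen_min (gen_subgroup B) _ => x /AB; apply: gen_in.
Qed.

Lemma commSubS A A' B B' : subset_of A A' -> subset_of B B' ->
  subset_of (commSub G A B) (commSub G A' B').
Proof.
move=> AA' BB'; apply: genS => _ [a [b [/AA' Aa [/BB' Bb ->]]]].
by exists a, b.
Qed.

Lemma derS A B n : subset_of A B -> subset_of (der G A n) (der G B n).
Proof. by move=> AB; elim: n => //= n IHn; apply: commSubS. Qed.

Lemma commSub_in A B a b : A a -> B b -> commSub G A B (comm G a b).
Proof. by move=> Aa Bb; apply: gen_in; exists a, b. Qed.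

Lemma comm_mem M x y : is_subgroup G M -> M x -> M y -> M (comm G x y).
Proof.
by case=> _ [MM MV] Mx My; apply: (MM); apply: (MM) => //; apply: MV.
Qed.

Lemma conj_mem M x y : is_subgroup G M -> M x -> M y -> M (conj x y).
Proof. by case=> _ [MM MV] Mx My; apply: (MM) => //; apply: MM => //; apply: MV. Qed.

Lemma commSub_min A B M : is_subgroup G M ->
  (forall a b, A a -> B b -> M (comm G a b)) -> subset_of (commSub G A B) M.
Proof. by move=> sM ABM; apply: gen_min => // _ [a [b [Aa [Bb ->]]]]; apply: ABM. Qed.

Lemma commSub_sub A B M : is_subgroup G M -> subset_of A M -> subset_of B M ->
  subset_of (commSub G A B) M.
Proof.
by move=> sM AM BM; apply: commSub_min => // a b /AM Ma /BM; apply: comm_mem.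
Qed.

Lemma commSub_normalized H A B :
  normalized H A -> normalized H B -> normalized H (commSub G A B).
Proof.
move=> nA nB h x Hh; elim=> [_ [a [b [Aa [Bb ->]]]]||u v _ Iu _ Iv|u _ Iu].
- by rewrite conj_comm; apply: commSub_in; [apply: nA | apply: nB].
- by rewrite conj1g; apply: gen_one.
- by rewrite conjM; apply: gen_mul.
- by rewrite conjV; apply: gen_inv.
Qed.

Lemma lcs_sub H n : is_subgroup G H -> subset_of (lcs G H n) H.
Proof. by move=> sH; elim: n => //= n IHn; apply: commSub_sub. Qed.

Lemma der_sub H n : is_subgroup G H -> subset_of (der G H n) H.
Proof. by move=> sH; elim: n => //= n IHn; apply: commSub_sub. Qed.

Lemma der_normal H n : is_normal G H -> is_normal G (der G H n).
Proof.
move=> nH; elim: n => //= n /is_normalP[sD nD]; apply/is_normalP.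
by split; [apply: gen_subgroup | apply: commSub_normalized].
Qed.

Lemma centralizer_subgroup (X : subset G) :
  is_subgroup G (fun z => forall x, X x -> x ∗ z = z ∗ x).
Proof.
split; first by move=> x _; group.
split=> [u v cu cv x Xx|u cu x Xx]; first by rewrite mulA cu // -mulA cv // mulA.
by apply: (@gmulgI _ u); rewrite gmulVKg mulA -cu //; group.
Qed.

Lemma centralizer_normal X : normalized (full G) X ->
  is_normal G (fun z => forall x, X x -> x ∗ z = z ∗ x).
Proof.
move=> nX; apply/is_normalP; split; first exact: centralizer_subgroup.
move=> h z _ cz x Xx; apply/conj_fixP; rewrite -(conjVK x h).
have Xxh : X (conj x h⁻¹) by apply: nX.
have /conj_fixP e := cz _ Xxh.
by rewrite -{2}e; group.
Qed.

(* [lcs H n] is the normal closure in [H] of the left-normed commutators of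
   weight n.+1 in the generators. *)
Lemma lcs_fin_gen_normal (l : list G) n : exists L : list G,
  (forall x, List.In x L -> lcs G (fin_gen G l) n x) /\
  (forall M, is_subgroup G M -> normalized (fin_gen G l) M ->
     (forall x, List.In x L -> M x) -> subset_of (lcs G (fin_gen G l) n) M).
Proof.
set H := fin_gen G l; have sH : is_subgroup G H by apply: gen_subgroup.
elim: n => [|n [L [LH Lmin]]].
  by exists l; split=> [x lx|M sM _ lM]; [apply: gen_in | apply: gen_min].
exists (List.flat_map (fun x => List.map (comm G x) l) L); split=> [z|M sM nM LM].
  case/List.in_flat_map=> x [/LH Lx /List.in_map_iff[g [<- lg]]].
  by apply: commSub_in => //; apply: gen_in.
have [M1 [MM MV]] := sM.
(* [C] is the preimage of the center of [H] modulo [M]. Once it is shown to contain [L], the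
   induction hypothesis puts the whole [n]-th term inside it. *)
pose C z := H z /\ forall h, H h -> M (comm G z h).
have sC : is_subgroup G C.
  split; first by split=> [|h _]; [apply: gen_one | group].
  split=> [u v [Hu Cu] [Hv Cv]|u [Hu Cu]].
    split=> [|h Hh]; first exact: gen_mul.
    suff -> : comm G (u ∗ v) h = conj (comm G u h) v ∗ comm G v h.
      by apply: (MM); [apply: nM => //; apply: Cu | apply: Cv].
    by group.
  split=> [|h Hh]; first exact: gen_inv.
  suff -> : comm G u⁻¹ h = conj (comm G u h)⁻¹ u⁻¹.
    by apply: nM; [apply: gen_inv | apply: MV; apply: Cu].
  by group.
have nC : normalized H C.
  move=> h x Hh [Hx Cx]; split=> [|g Hg]; first exact: conj_mem.
  rewrite -(conjVK g h) -conj_comm; apply: nM => //; apply: Cx.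
  by apply: conj_mem => //; apply: gen_inv.
have LC x : List.In x L -> C x.
  move=> Lx; have Hx := lcs_sub sH (LH _ Lx); split=> // h.
  (* Only the commutators with the generators in [l] are given to lie in [M]; induction on [h]
     extends this to all of [H]. *)
  elim=> [g lg||u v Hu Iu Hv Iv|u Hu Iu].
  - apply: LM; apply/List.in_flat_map; exists x; split=> //.
    exact: List.in_map.
  - by suff -> : comm G x one = one by []; group.
  - suff -> : comm G x (u ∗ v) = comm G x v ∗ conj (comm G x u) v.
      by apply: MM => //; apply: nM.
    by group.
  - suff -> : comm G x u⁻¹ = conj (comm G x u)⁻¹ u⁻¹.
      by apply: nM; [apply: gen_inv | apply: MV].
    by group.
apply: commSub_min => // a b /(Lmin C sC nC LC) [_ Ca]; exact: Ca.
Qed.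

End Subgroups.

(** * The quotient of a subgroup by a subgroup that it normalizes *)

Section Quotient.

Variables (G : Group) (H N : subset G).
Hypotheses (sH : is_subgroup G H) (sN : is_subgroup G N).
Hypothesis nN : normalized H N.

Definition coset (x z : G) : Prop := N (x⁻¹ ∗ z).

(** The elements are the cosets themselves, as predicates, so that the group axioms hold for plain
    equality; the operations go through chosen representatives. *)
Definition cosets := {C : G -> Prop | exists x, H x /\ C = coset x}.

Lemma eq_coset x y : coset x = coset y <-> N (x⁻¹ ∗ y).
Proof.
have [N1 [NM NV]] := sN; split=> [e|Nxy].
  by rewrite -/(coset x y) e /coset mulVg.
apply/funext => z; apply/propext; rewrite /coset; split=> Nz.
  suff -> : y⁻¹ ∗ z = (x⁻¹ ∗ y)⁻¹ ∗ (x⁻¹ ∗ z) by apply: NM => //; apply: NV.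
  by group.
suff -> : x⁻¹ ∗ z = (x⁻¹ ∗ y) ∗ (y⁻¹ ∗ z) by apply: NM.
by group.
Qed.

Definition coset_repr (C : cosets) : G := sval (cid (proj2_sig C)).

Lemma coset_repr_in C : H (coset_repr C).
Proof. by rewrite /coset_repr; case: cid => x []. Qed.

Lemma coset_reprE C : sval C = coset (coset_repr C).
Proof. by rewrite /coset_repr; case: cid => x []. Qed.

Definition to_coset x (Hx : H x) : cosets :=
  exist _ (coset x) (ex_intro _ x (Logic.conj Hx erefl)).

Lemma to_coset_eq x y (Hx : H x) (Hy : H y) :
  to_coset Hx = to_coset Hy <-> N (x⁻¹ ∗ y).
Proof.
rewrite -eq_coset; split=> [/(congr1 sval) //|e].
exact: eq_exist.
Qed.

Lemma coset_reprK C : to_coset (coset_repr_in C) = C.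
Proof. by case: C (coset_repr_in C) (coset_reprE C) => D [x Dx] HC e; apply: eq_exist. Qed.

Definition coset_one := to_coset sH.1.

Definition coset_mul C D :=
  to_coset (sH.2.1 _ _ (coset_repr_in C) (coset_repr_in D)).

Definition coset_inv C := to_coset (sH.2.2 _ (coset_repr_in C)).

Lemma coset_repr_to x (Hx : H x) : N ((coset_repr (to_coset Hx))⁻¹ ∗ x).
Proof. by apply/(to_coset_eq (coset_repr_in _) Hx); apply: coset_reprK. Qed.

Lemma coset_mulE x y (Hx : H x) (Hy : H y) (Hxy : H (x ∗ y)) :
  coset_mul (to_coset Hx) (to_coset Hy) = to_coset Hxy.
Proof.
apply/to_coset_eq; have Nx := coset_repr_to Hx; have Ny := coset_repr_to Hy.
set u := coset_repr _ in Nx *; set v := coset_repr _ in Ny *.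
suff -> : (u ∗ v)⁻¹ ∗ (x ∗ y) = (v⁻¹ ∗ y) ∗ conj (u⁻¹ ∗ x) y.
  by apply: sN.2.1 => //; apply: nN.
by group.
Qed.

Lemma coset_mulA : forall C D E,
  coset_mul C (coset_mul D E) = coset_mul (coset_mul C D) E.
Proof.
move=> C D E; rewrite -(coset_reprK C) -(coset_reprK D) -(coset_reprK E).
move: (coset_repr_in C) (coset_repr_in D) (coset_repr_in E).
move: (coset_repr C) (coset_repr D) (coset_repr E) => x y z Hx Hy Hz.
have HM := sH.2.1.
rewrite (coset_mulE Hy Hz (HM _ _ Hy Hz)) (coset_mulE Hx Hy (HM _ _ Hx Hy)).
rewrite (coset_mulE Hx _ (HM _ _ Hx (HM _ _ Hy Hz))).
rewrite (coset_mulE _ Hz (HM _ _ (HM _ _ Hx Hy) Hz)).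
by apply/to_coset_eq; group; apply: sN.1.
Qed.

Lemma coset_mul1 : forall C, coset_mul coset_one C = C.
Proof.
move=> C; rewrite -(coset_reprK C); move: (coset_repr_in C).
move: (coset_repr C) => x Hx; rewrite (coset_mulE _ Hx (sH.2.1 _ _ sH.1 Hx)).
by apply/to_coset_eq; rewrite mul1g mulVg; apply: sN.1.
Qed.

Lemma coset_mulV : forall C, coset_mul (coset_inv C) C = coset_one.
Proof.
move=> C; rewrite -{2}(coset_reprK C) /coset_inv; move: (coset_repr_in C).
move: (coset_repr C) => x Hx; have Hx' := sH.2.2 _ Hx.
rewrite (coset_mulE _ Hx (sH.2.1 _ _ Hx' Hx)).
by apply/to_coset_eq; rewrite mulVg ginv1 mul1g; apply: sN.1.
Qed.

Definition quotient_group : Group :=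
  Build_Group cosets coset_mul coset_inv coset_one coset_mulA coset_mul1 coset_mulV.

(* Constant outside [H], where the projection is not defined. *)
Definition quotient_proj (x : G) : quotient_group :=
  if pselect (H x) is left Hx then to_coset Hx else coset_one.

Lemma quotient_projE x (Hx : H x) : quotient_proj x = to_coset Hx.
Proof.
rewrite /quotient_proj; case: pselect => // Hx'; apply/to_coset_eq.
by rewrite mulVg; apply: sN.1.
Qed.

Lemma quotient_proj_onto : hom_onto G H quotient_group quotient_proj.
Proof.
split=> [x y Hx Hy|C]; last first.
  exists (coset_repr C); split; first exact: coset_repr_in.
  by rewrite (quotient_projE (coset_repr_in C)) coset_reprK.
have Hxy := sH.2.1 _ _ Hx Hy.
by rewrite (quotient_projE Hx) (quotient_projE Hy) (quotient_projE Hxy) -coset_mulE.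
Qed.

Lemma quotient_proj_ker x : H x -> (quotient_proj x = one <-> N x).
Proof.
move=> Hx; rewrite (quotient_projE Hx); split=> [/esym/to_coset_eq|Nx].
  by rewrite ginv1 mul1g.
by apply/esym/to_coset_eq; rewrite ginv1 mul1g.
Qed.

End Quotient.

(** * Transfer along a surjective homomorphism *)

Section Transfer.

Variables (G Q : Group) (H : subset G) (f : G -> Q).
Hypotheses (sH : is_subgroup G H) (fP : hom_onto G H Q f).

Definition img (X : subset G) : subset Q := fun q => exists x, X x /\ f x = q.
Definition preimg (K : subset Q) : subset G := fun x => H x /\ K (f x).

Lemma hom1 : f one = one.
Proof.
have [H1 _] := sH; apply: (@gmulgI _ (f one)); rewrite -fP.1 // mul1g.
by rewrite gmulg1.
Qed.

Lemma homV x : H x -> f x⁻¹ = (f x)⁻¹.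
Proof.
have [_ [_ HV]] := sH => Hx; apply: (@gmulgI _ (f x)).
by rewrite -fP.1 ?gmulgV ?hom1 //; apply: HV.
Qed.

Lemma hom_conj x g : H x -> H g -> f (conj x g) = conj (f x) (f g).
Proof.
have [_ [HM HV]] := sH => Hx Hg; have Hg' := HV _ Hg.
by rewrite /conj !fP.1 ?homV //; apply: HM.
Qed.

Lemma hom_comm x y : H x -> H y -> f (comm G x y) = comm Q (f x) (f y).
Proof.
have [_ [HM HV]] := sH => Hx Hy.
by rewrite /comm !fP.1 ?homV //; repeat first [apply: (HM) | apply: (HV)].
Qed.

Lemma preimg_subgroup K : is_subgroup Q K -> is_subgroup G (preimg K).
Proof.
have [H1 [HM HV]] := sH => -[K1 [KM KV]]; split; first by rewrite /preimg hom1.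
split=> [x y [Hx Kx] [Hy Ky]|x [Hx Kx]]; split.
- exact: HM.
- by rewrite fP.1 //; apply: KM.
- exact: HV.
- by rewrite homV //; apply: KV.
Qed.

Lemma img_gen (X : subset G) (Y : subset Q) : subset_of X H ->
  subset_of Y (img X) -> subset_of (gen Q Y) (img (gen G X)).
Proof.
move=> XH YX; have gH := gen_min sH XH.
move=> q; elim=> [a /YX[x [Xx <-]]||_ _ _ [x [gx <-]] _ [y [gy <-]]|_ _ [x [gx <-]]].
- by exists x; split=> //; apply: gen_in.
- by exists one; split; [apply: gen_one | apply: hom1].
- by exists (x ∗ y); split; [apply: gen_mul | rewrite fP.1 //; apply: gH].
- by exists x⁻¹; split; [apply: gen_inv | rewrite homV //; apply: gH].
Qed.

Lemma img_commSub (X1 X2 : subset G) (Y1 Y2 : subset Q) :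
  subset_of X1 H -> subset_of X2 H ->
  subset_of Y1 (img X1) -> subset_of Y2 (img X2) ->
  subset_of (commSub Q Y1 Y2) (img (commSub G X1 X2)).
Proof.
move=> XH1 XH2 YX1 YX2; apply: img_gen.
  by move=> _ [a [b [/XH1 Ha [/XH2 Hb ->]]]]; apply: comm_mem.
move=> _ [_ [_ [/YX1[a [Xa <-]] [/YX2[b [Xb <-]] ->]]]].
by exists (comm G a b); split; [exists a, b | apply: hom_comm; auto].
Qed.

Lemma img_lcs (X : subset G) (Y : subset Q) n : is_subgroup G X ->
  subset_of X H -> subset_of Y (img X) -> subset_of (lcs Q Y n) (img (lcs G X n)).
Proof.
move=> sX XH YX; elim: n => //= n IHn; apply: img_commSub => //.
by move=> x /(lcs_sub sX) /XH.
Qed.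

Lemma img_der (X : subset G) (Y : subset Q) n : is_subgroup G X ->
  subset_of X H -> subset_of Y (img X) -> subset_of (der Q Y n) (img (der G X n)).
Proof.
move=> sX XH YX; elim: n => //= n IHn.
by apply: img_commSub => // x /(der_sub sX) /XH.
Qed.

Lemma hom_lcs n x : lcs G H n x -> lcs Q (full Q) n (f x).
Proof.
elim: n x => //= n IHn x xn.
have [] : H x /\ commSub Q (lcs Q (full Q) n) (full Q) (f x); last by [].
have [H1 [HM HV]] := sH.
elim: xn => [_ [a [b [aH [Hb ->]]]]||u v _ [Hu Iu] _ [Hv Iv]|u _ [Hu Iu]].
- have Ha := lcs_sub sH aH; split; first exact: comm_mem.
  by rewrite hom_comm //; apply: commSub_in => //; apply: IHn.
- by rewrite hom1; split=> //; apply: gen_one.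
- by split; [apply: HM | rewrite fP.1 //; apply: gen_mul].
- by split; [apply: HV | rewrite homV //; apply: gen_inv].
Qed.

(** Nilpotency passes to images, so the preimage of a non-nilpotent subgroup is non-nilpotent, hence
    normal, and normality descends along [f]. *)
Lemma meta_Nil_Hamiltonian_image :
  meta_Nil_Hamiltonian G -> meta_Nil_Hamiltonian Q.
Proof.
move=> mG K sK nK; split=> // g k Kk.
have [[x [Hx <-]] [y [Hy yk]]] := (fP.2 g, fP.2 k).
have sP := preimg_subgroup sK.
have [|_ nP] := mG _ sP.
  case=> n tn; apply: nK; exists n => q.
  have KP : subset_of K (img (preimg K)).
    by move=> q'; have [z [Hz <-]] := fP.2 q'; exists z.
  have PH : subset_of (preimg K) H by move=> z [].
  by case/(img_lcs sP PH KP)=> z [/tn -> <-]; apply: hom1.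
have [_] : preimg K (conj y x) by apply: nP; split; rewrite ?yk.
by rewrite hom_conj // yk.
Qed.

Lemma soluble_by_finite_image : soluble_by_finite G -> soluble_by_finite Q.
Proof.
case=> S [/is_normalP[sS nS] [[n tn] [l lP]]].
have [[S1 [SM SV]] [H1 [HM HV]]] := (sS, sH).
pose T x := S x /\ H x.
have sT : is_subgroup G T.
  split=> //; split=> [x y [Sx Hx] [Sy Hy]|x [Sx Hx]]; split; auto.
exists (img T); split; [|split].
- apply/is_normalP; split; last first.
    move=> q _ _ [x [[Sx Hx] <-]]; have [g [Hg <-]] := fP.2 q.
    exists (conj x g); split; last exact: hom_conj.
    by split; [apply: nS | apply: conj_mem].
  split; first by exists one; split; [split | apply: hom1].
  split=> [_ _ [x [Tx <-]] [y [Ty <-]]|_ [x [Tx <-]]].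
    by exists (x ∗ y); split; [apply: sT.2.1 | rewrite fP.1 //; [case: Tx | case: Ty]].
  by exists x⁻¹; split; [apply: sT.2.2 | apply: homV; case: Tx].
- have TH : subset_of T H by move=> x [].
  exists n => q /(img_der sT TH (fun _ => id))[x [xT <-]].
  by rewrite (tn x) ?hom1 //; apply: derS xT => z [].
- pose rep g := if pselect (exists h, H h /\ S (g⁻¹ ∗ h)) is left e
                then sval (cid e) else one.
  exists (List.map (fun g => f (rep g)) l) => q.
  have [x [Hx <-]] := fP.2 q; have [g [s [lg [Ss xE]]]] := lP x.
  have [Hr Sr] : H (rep g) /\ S (g⁻¹ ∗ rep g).
    rewrite /rep; case: pselect => [e|[]]; first by case: cid.
    by exists x; split=> //; rewrite xE gmulKg.
  have Hrx : H ((rep g)⁻¹ ∗ x) by auto.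
  exists (f (rep g)), (f ((rep g)⁻¹ ∗ x)); split; last split.
  + by apply/List.in_map_iff; exists g.
  + exists ((rep g)⁻¹ ∗ x); split=> //; split=> //.
    suff -> : (rep g)⁻¹ ∗ x = (g⁻¹ ∗ rep g)⁻¹ ∗ s by auto.
    by rewrite xE; group.
  + by rewrite -fP.1 // gmulVKg.
Qed.

End Transfer.

(** * Just-non-nilpotent quotients *)

Section MaximalNormal.

Variables (G : Group) (l : list G).
Let H := fin_gen G l.
Hypothesis nonnilH : ~ nilpotent G H.

(** The last clause says that [H / N] is not nilpotent, without forming the quotient. *)
Definition non_nilpotent_modulo (N : subset G) :=
  [/\ is_subgroup G N, subset_of N H, normalized H N &
      forall n, ~ subset_of (lcs G H n) N].

Lemma trivial_non_nilpotent_modulo : non_nilpotent_modulo (fun x => x = one).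
Proof.
split.
- by split=> //; split=> [x y -> ->|x ->]; group.
- by move=> x ->; apply: gen_one.
- by move=> h x _ ->; rewrite conj1g.
- by move=> n tn; apply: nonnilH; exists n.
Qed.

Lemma non_nilpotent_modulo_maximal : exists N, non_nilpotent_modulo N /\
  forall M, is_subgroup G M -> subset_of M H -> normalized H M ->
    subset_of N M -> ~ subset_of M N -> exists n, subset_of (lcs G H n) M.
Proof.
pose T := {N : subset G | non_nilpotent_modulo N}.
pose R (N M : T) := `[< subset_of (sval N) (sval M) >].
have [||A chainA|N Nmax] := @ZL_preorder T
    (exist _ _ trivial_non_nilpotent_modulo) R.
- by move=> N; apply/asboolP.
- by move=> N1 N2 N3 /asboolP N12 /asboolP N23; apply/asboolP => x /N12 /N23.
(* Adjoining [one] gives the empty chain an upper bound as well. *)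
- pose U x := x = one \/ exists2 N : T, A N & sval N x.
  have chain2 x y : U x -> U y ->
      (x = one /\ y = one) \/ exists2 N : T, A N & sval N x /\ sval N y.
    have N1 (N : T) : sval N one by case: (proj2_sig N) => -[].
    move=> [-> [->|[N AN Ny]]|[N AN Nx] [->|[N' AN' Ny]]]; first by left.
    - by right; exists N.
    - by right; exists N.
    - right; have [/asboolP NN|/asboolP NN] := chainA _ _ AN AN'.
        by exists N' => //; split=> //; apply: NN.
      by exists N => //; split=> //; apply: NN.
  have sU : is_subgroup G U.
    split; first by left.
    split=> [x y Ux Uy|x Ux].
      case: (chain2 _ _ Ux Uy) => [[-> ->]|[N AN [Nx Ny]]]; first by left; group.
      by right; exists N => //; case: (proj2_sig N) => -[_ [NM _]] _ _ _; apply: NM.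
    case: Ux => [->|[N AN Nx]]; first by left; group.
    by right; exists N => //; case: (proj2_sig N) => -[_ [_ NV]] _ _ _; apply: NV.
  have goodU : non_nilpotent_modulo U.
    split=> //.
    - move=> x [->|[N _ Nx]]; first exact: gen_one.
      by case: (proj2_sig N) => _ NH _ _; apply: NH.
    - move=> h x Hh [->|[N AN Nx]]; first by left; rewrite conj1g.
      by right; exists N => //; case: (proj2_sig N) => _ _ nN _; apply: nN.
    (* If the union contained a term of the series, the finitely many normal generators of that term
       would lie in a single member of the chain. *)
    - move=> n nU; have [L [LH Lmin]] := lcs_fin_gen_normal l n.
      have : (forall x, List.In x L -> x = one) \/
             exists2 N : T, A N & forall x, List.In x L -> sval N x.
        have LU x : List.In x L -> U x by move/LH/nU.
        elim: L LU {LH Lmin} => [|x L IHL] LU; first by left.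
        have N1 (N : T) : sval N one by case: (proj2_sig N) => -[].
        have [L1|[N AN NL]] := IHL (fun y Ly => LU y (or_intror Ly)).
          case: (LU x (or_introl erefl)) => [->|[N AN Nx]].
            by left=> y [<-//|/L1].
          by right; exists N => // y [<-//|/L1 ->].
        case: (LU x (or_introl erefl)) => [->|[N' AN' Nx]].
          by right; exists N => // y [<-//|/NL].
        right; have [/asboolP NN|/asboolP NN] := chainA _ _ AN AN'.
          by exists N' => // y [<-//|/NL /NN].
        by exists N => // y [<-|/NL //]; apply: NN.
      have [s1 _ n1 nn1] := trivial_non_nilpotent_modulo.
      case=> [L1|[N AN NL]]; first exact: (nn1 n (Lmin _ s1 n1 L1)).
      by case: (proj2_sig N) => sN _ nN nnN; apply: (nnN n); apply: Lmin.
  exists (exist _ U goodU) => N AN; apply/asboolP => x Nx; right.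
  by exists N.
exists (sval N); split; first exact: (proj2_sig N).
move=> M sM MH nM NM MN; apply: contrapT => noM.
have goodM : non_nilpotent_modulo M.
  by split=> // n nMn; apply: noM; exists n.
apply: MN; have /asboolP : R (exist _ M goodM) N; last by [].
by apply: Nmax; apply/asboolP.
Qed.

End MaximalNormal.

(** The two proofs are parameters of the type, so that an additive group structure can be attached
    to it and the results on simple modules apply to [A]. *)
Record abelian_sub (G : Group) (A : subset G) (sA : is_subgroup G A)
  (cA : forall x y, A x -> A y -> x ∗ y = y ∗ x) :=
  AbelianSub { abval :> G; abvalP : A abval }.

Section AbelianSubZmodule.

Variables (G : Group) (A : subset G) (sA : is_subgroup G A).
Variable cA : forall x y, A x -> A y -> x ∗ y = y ∗ x.

Local Notation V := (abelian_sub sA cA).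

Lemma abval_inj : injective (@abval G A sA cA).
Proof.
by case=> x Ax [y Ay] /= e; subst y; congr AbelianSub; apply: Prop_irrelevance.
Qed.

HB.instance Definition _ := gen_eqMixin V.
HB.instance Definition _ := gen_choiceMixin V.

Definition ab_zero : V := AbelianSub sA cA sA.1.
Definition ab_opp (u : V) : V := AbelianSub sA cA (sA.2.2 _ (abvalP u)).
Definition ab_add (u v : V) : V :=
  AbelianSub sA cA (sA.2.1 _ _ (abvalP u) (abvalP v)).

Lemma ab_addA : associative ab_add.
Proof. by move=> u v w; apply: abval_inj; apply: mulA. Qed.

Lemma ab_addC : commutative ab_add.
Proof. by move=> u v; apply: abval_inj; apply: cA; apply: abvalP. Qed.

Lemma ab_add0 : left_id ab_zero ab_add.
Proof. by move=> u; apply: abval_inj; apply: mul1g. Qed.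

Lemma ab_addN : left_inverse ab_zero ab_opp ab_add.
Proof. by move=> u; apply: abval_inj; apply: mulVg. Qed.

HB.instance Definition _ :=
  GRing.isZmodule.Build V ab_addA ab_addC ab_add0 ab_addN.

End AbelianSubZmodule.

Lemma lists_of_size_finite (T : Type) (l : list T) n : exists L : list (list T),
  forall s, size s = n -> (forall x, List.In x s -> List.In x l) -> List.In s L.
Proof.
elim: n => [|n [L LP]]; first by exists [:: [::]] => s /size0nil -> _; left.
exists (List.flat_map (fun x => List.map (cons x) L) l) => -[//|x s] [sn] sl.
apply/List.in_flat_map; exists x; split; first by apply: sl; left.
by apply: List.in_map; apply: LP => // y ys; apply: sl; right.
Qed.

(** An element of [X] is determined by the list of its values along [lT], and there are finitely
    many such lists. *)
Lemma finite_of_faithful_action (G : Group) (X T : subset G) (lT : list G) :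
  (forall t, T t -> List.In t lT) -> normalized X T ->
  (forall x y, X x -> X y -> (forall t, T t -> conj t x = conj t y) -> x = y) ->
  exists lX : list G, forall x, X x -> List.In x lX.
Proof.
move=> TlT nT faith.
pose F x := List.map (fun t => if pselect (T t) then conj t x else one) lT.
(* [one] is the value recorded at the entries of [lT] outside [T]. *)
have [L LP] := lists_of_size_finite (one :: lT) (size lT).
pose g s := if pselect (exists x, X x /\ F x = s) is left e
            then sval (cid e) else one.
exists (List.map g L) => x Xx; apply/List.in_map_iff; exists (F x); split.
  rewrite /g; case: pselect => [e|[]]; last by exists x.
  case: cid => y /= [Xy Fyx]; apply: faith => // t Tt.
  have := Fyx; rewrite /F => /List.ext_in_map /(_ t (TlT t Tt)).
  by case: pselect.
apply: LP => [|z]; first by rewrite /F; elim: (lT) => //= ? ? ->.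
case/List.in_map_iff=> t [<- _]; case: pselect => Tt; last by left.
by right; apply: TlT; apply: nT.
Qed.

(** * Non-nilpotent groups whose proper quotients are nilpotent *)

Section JustNonNilpotent.

Variable G : Group.
Hypothesis mG : meta_Nil_Hamiltonian G.
Hypothesis nonnilG : ~ nilpotent G (full G).
Hypothesis justG : forall M : subset G, is_normal G M ->
  (exists x, M x /\ x <> one) -> exists n, subset_of (lcs G (full G) n) M.

(** Otherwise the center is a nontrivial normal subgroup, so [G] modulo its center is nilpotent, and
    then so is [G]. *)
Lemma center_trivial (z : G) : (forall g, g ∗ z = z ∗ g) -> z = one.
Proof.
move=> cz; apply: contrapT => z1; apply: nonnilG.
have fullN : normalized (full G) (full G) by [].
have [|n nC] := justG (centralizer_normal fullN).
  by exists z; split=> // g _; apply: cz.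
exists n.+1; apply: commSub_min => [|a b /nC ca _].
  by split=> //; split=> [x y -> ->|x ->]; group.
by have := ca b Logic.I; rewrite /comm => e; rewrite -e; group.
Qed.

Section AbelianNormal.

Variable A : subset G.
Hypotheses (nA : is_normal G A) (cA : forall x y, A x -> A y -> x ∗ y = y ∗ x).
Variable a1 : G.
Hypotheses (Aa1 : A a1) (a11 : a1 <> one).

Let sA : is_subgroup G A := nA.1.
Let A1 := sA.1.
Let AM := sA.2.1.
Let AV := sA.2.2.

Let AJ x g : A x -> A (conj x g).
Proof. exact: nA.2. Qed.

Definition centA (z : G) := forall a, A a -> a ∗ z = z ∗ a.

Let normalA : normalized (full G) A.
Proof. by move=> h x _; apply: AJ. Qed.

(** The centralizer contains [a1], so it contains a term of the lower central series; [y] is taken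
    in the last term not inside it. Such a term exists, since otherwise [a1] would be central. *)
Lemma exists_central_modulo_centA :
  exists y, ~ centA y /\ forall h, centA (comm G y h).
Proof.
have [|n nD] := justG (centralizer_normal normalA).
  by exists a1; split=> // a Aa; apply: cA.
elim: n nD => [nD|n IHn nD].
  by case: a11; apply: center_trivial => g; apply/esym/(nD g).
have [/IHn //|nsub] := pselect (subset_of (lcs G (full G) n) centA).
have [y [ny Dy]] : exists y, lcs G (full G) n y /\ ~ centA y.
  apply: contrapT => no; apply: nsub => y ny.
  by apply: contrapT => Dy; apply: no; exists y.
by exists y; split=> // h; apply: nD; apply: commSub_in.
Qed.

Variable y : G.
Hypotheses (Dy : ~ centA y) (Dyh : forall h, centA (comm G y h)).

(** The actions of [y] and [h] on [A] commute because their commutator centralizes [A]. *)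
Lemma conj_swap a h : A a -> conj (conj a y) h = conj (conj a h) y.
Proof.
move=> Aa; rewrite -!conjMr.
have -> : y ∗ h = h ∗ y ∗ comm G y h by group.
by rewrite conjMr; apply/conj_fixP; apply: Dyh; apply: AJ.
Qed.

(* The fixed points of [y] form a normal subgroup [M].  If [M] were nontrivial,
   [G / M] would be nilpotent; as [b |-> [b, y]] commutes with the action of
   [G], the absence of central elements then pushes "[y] fixes [A] inter
   [lcs G n]" down to [n = 0]. *)
Lemma fixed_point_free a : A a -> conj a y = a -> a = one.
Proof.
move=> Aa ay; apply: contrapT => a0.
have [||n nM] := @justG (fun x => A x /\ conj x y = x); last 1 first.
- case: Dy => b Ab; apply/conj_fixP.
  suff fixi k : k <= n ->
      forall c, A c -> lcs G (full G) (n - k) c -> conj c y = c.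
    by apply: (fixi n (leqnn n)); rewrite ?subnn.
  elim: k => [_ c _|k IHk lt_kn c Ac cn].
    by rewrite subn0 => /nM[].
  apply/comm1P/center_trivial => h.
  have fix_ch : conj (comm G c h) y = comm G c h.
    apply: IHk (ltnW lt_kn) _ _ _.
      by rewrite commE; apply: AM; [apply: AV | apply: AJ].
    by rewrite -(subnSK lt_kn); apply: commSub_in.
  (* With [p] and [q] the conjugates of [c] by [y] and [h], the invariance of [[c, h]] under [y]
     says that [p^-1 p^h = c^-1 q]; as [A] is abelian, this makes [[c, y] = c^-1 p] invariant under
     [h]. *)
  apply/esym/conj_fixP; rewrite commE conjM conjV.
  move: fix_ch; rewrite commE conjM conjV -conj_swap //.
  have [Ay Ah] := (AJ y Ac, AJ h Ac).
  set p := conj c y in Ay *; set q := conj c h in Ah *.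
  move=> e; have -> : conj p h = p ∗ (c⁻¹ ∗ q) by rewrite -e gmulVKg.
  by rewrite (mulA _ p) (cA Ay (AV Ac)) (cA (AM (AV Ac) Ay) Ah); group.
- apply/is_normalP; split.
    split; first by rewrite conj1g.
    split=> [u v [Au eu] [Av ev]|u [Au eu]].
      by split; [apply: AM | rewrite conjM eu ev].
    by split; [apply: AV | rewrite conjV eu].
  move=> h u _ [Au eu]; split; first exact: AJ.
  by rewrite -conj_swap // eu.
- by exists a.
Qed.

Local Notation V := (abelian_sub sA cA).

Definition act g (v : V) : V := AbelianSub sA cA (AJ g (abvalP v)).

Let phi := act y.
Let psi := act y⁻¹.

Let phiB : {morph phi : u v / (u - v)%R}.
Proof. by move=> u v; apply: abval_inj; rewrite /= conjM conjV. Qed.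

Let phiK : cancel phi psi.
Proof. by move=> v; apply: abval_inj; apply: conjK. Qed.

Let psiK : cancel psi phi.
Proof. by move=> v; apply: abval_inj; apply: conjVK. Qed.

Let iter_phiB n : {morph iter n phi : u v / (u - v)%R}.
Proof. by move=> u v; elim: n => //= n ->; rewrite phiB. Qed.

Let phi_sub1_inj u v : (phi u - u = phi v - v)%R -> u = v.
Proof.
move=> e; apply/eqP; rewrite -subr_eq0; apply/eqP; apply: abval_inj.
apply: fixed_point_free; first exact: abvalP.
rewrite -[conj _ y]/(abval (phi (u - v)%R)); congr abval.
move/eqP: e; rewrite phiB subr_eq => /eqP ->.
by rewrite -(addrA (phi v)) [(- v + u)%R]addrC addrAC subrr add0r.
Qed.

Definition cyclic_module (b v : V) := exists n, cyclic_span phi b (iter n phi v).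

Let span_iter n b u : cyclic_span phi b u -> cyclic_span phi b (iter n phi u).
Proof. by move=> bu; elim: n => //= n; apply: span_phi. Qed.

Lemma cyclic_module_gen b : cyclic_module b b.
Proof. by exists 0; apply: span_gen. Qed.

Lemma cyclic_module_sub b u v :
  cyclic_module b u -> cyclic_module b v -> cyclic_module b (u - v)%R.
Proof.
move=> [n bu] [m bv]; exists (n + m); rewrite iter_phiB iterD addnC iterD.
apply: span_sub; last by rewrite -iterD addnC iterD; apply: span_iter.
by rewrite -iterD addnC iterD; apply: span_iter.
Qed.

Lemma cyclic_module_phi b v : cyclic_module b (phi v) <-> cyclic_module b v.
Proof.
split=> -[n bv]; first by exists n.+1; rewrite iterSr.
by exists n; rewrite -iterSr iterS; apply: span_phi.
Qed.

Let Y := gen G (eq y).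

Lemma cycle_centralizes u : Y u -> conj u y = u.
Proof.
have yC : subset_of (eq y) (fun z => forall x, y = x -> x ∗ z = z ∗ x).
  by move=> x <- _ <-.
by move/(gen_min (centralizer_subgroup _) yC)/(_ y erefl)/esym/conj_fixP.
Qed.

Lemma cyclic_module_act b u v :
  Y u -> (cyclic_module b (act u v) <-> cyclic_module b v).
Proof.
move=> Yu; elim: Yu v => [_ <- v||g h _ Ig _ Ih v|g _ Ig v].
- exact: cyclic_module_phi.
- by move=> v; suff -> : act one v = v by []; apply: abval_inj; apply: conjg1.
- suff -> : act (g ∗ h) v = act h (act g v) by rewrite Ih.
  by apply: abval_inj; apply: conjMr.
- rewrite -Ig; suff -> : act g (act g⁻¹ v) = v by [].
  by apply: abval_inj; apply: conjVK.
Qed.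

Definition two_gen b := gen G (fun x => x = y \/ x = b).

(** [Y] acts on the submodule generated by [b], so the set of products is closed under the group
    operations. *)
Lemma two_gen_decomposition (b : V) z : two_gen b z ->
  exists u v, [/\ Y u, cyclic_module b v & z = u ∗ abval v].
Proof.
have cm0 : cyclic_module b 0%R.
  by rewrite -(subrr b); apply: cyclic_module_sub; apply: cyclic_module_gen.
have cmN v : cyclic_module b v -> cyclic_module b (- v)%R.
  by rewrite -sub0r; apply: cyclic_module_sub.
elim=> [_ [->|->]||_ _ _ [g [u [Yg bu ->]]] _ [h [v [Yh bv ->]]]|_ _ [g [u [Yg bu ->]]]].
- by exists y, 0%R; split=> //; [apply: gen_in | rewrite gmulg1].
- exists one, b; split; [exact: gen_one | exact: cyclic_module_gen |].
  by rewrite mul1g.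
- by exists one, 0%R; split=> //; [apply: gen_one | rewrite gmulg1].
- exists (g ∗ h), (act h u + v)%R; split; [exact: gen_mul | | by rewrite /=; group].
  by rewrite -[v]opprK; apply: cyclic_module_sub; [apply/cyclic_module_act | apply: cmN].
- exists g⁻¹, (act g⁻¹ (- u))%R; split; [exact: gen_inv | | by rewrite /=; group].
  by apply/cyclic_module_act; [apply: gen_inv | apply: cmN].
Qed.

(** By [fixed_point_free] the iterated commutators of [b] with [y] never become trivial, so no term
    of the lower central series of [two_gen b] does. *)
Lemma two_gen_normal b : A b -> b <> one -> is_normal G (two_gen b).
Proof.
move=> Ab b1; apply: mG; first exact: gen_subgroup.
case=> n; move: (n) => k; have : exists c, [/\ A c, c <> one & lcs G (two_gen b) k c].
  elim: k => [|k [c [Ac c1 ck]]]; first by exists b; split=> //; apply: gen_in; right.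
  exists (comm G c y); split.
  - by rewrite commE; apply: AM; [apply: AV | apply: AJ].
  - by move/comm1P/(fixed_point_free Ac).
  - by apply: commSub_in => //; apply: gen_in; left.
by case=> c [_ c1 ck] /(_ c ck).
Qed.

(** Normality puts [[v, y]] in [two_gen b]. The [Y]-part of its decomposition lies in [A] and is
    fixed by [y], hence is trivial, which leaves an element of the submodule. *)
Lemma cyclic_module_phi_sub1 (v b : V) :
  b != 0%R -> cyclic_module b (phi v - v)%R.
Proof.
move=> b0; have Kn : is_normal G (two_gen b).
  apply: two_gen_normal; first exact: abvalP.
  by move=> b1; case/eqP: b0; apply: abval_inj.
have [[_ [KM KV]] KJ] := Kn.
have Ky : two_gen b y by apply: gen_in; left.
have : two_gen b (comm G v y).
  suff -> : comm G v y = (conj y v)⁻¹ ∗ y by apply: KM => //; apply: KV; apply: KJ.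
  by group.
case/two_gen_decomposition=> u [w [Yu bw e]].
have Av := abvalP v; have Aw := abvalP w.
have Avy : A (comm G v y) by rewrite commE; apply: AM; [apply: AV | apply: AJ].
have Au : A u.
  suff -> : u = comm G v y ∗ (abval w)⁻¹ by apply: AM => //; apply: AV.
  by rewrite e; group.
have u1 : u = one by apply: fixed_point_free => //; apply: cycle_centralizes.
suff -> : (phi v - v)%R = w by [].
apply: abval_inj; rewrite /= cA; [|exact: AJ|exact: AV].
by rewrite -commE e u1 mul1g.
Qed.

(** The previous lemma is applied to the generator [phi b - b]. As [phi - 1] commutes with [phi],
    the span of this element lies in the image under [phi - 1] of the span of [b], and injectivity
    of [phi - 1] cancels it. *)
Lemma cyclic_module_full (v b : V) : b != 0%R -> cyclic_module b v.
Proof.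
move=> b0; have b'0 : (phi b - b != 0)%R.
  apply: contra b0 => /eqP e; apply/eqP; apply: phi_sub1_inj.
  rewrite e subr0; apply/esym; apply: abval_inj; exact: conj1g.
have [n] := cyclic_module_phi_sub1 v b'0; rewrite iter_phiB -iterSr iterS.
have spanP w : cyclic_span phi (phi b - b)%R w ->
    exists2 w', w = (phi w' - w')%R & cyclic_span phi b w'.
  elim=> [|_ _ _ [u1 -> b1] _ [u2 -> b2]|_ _ [u -> bu]].
  - by exists b => //; apply: span_gen.
  - exists (u1 - u2)%R; last exact: span_sub.
    by rewrite phiB !opprD !opprK addrACA.
  - by exists (phi u); [rewrite phiB | apply: span_phi].
by case/spanP=> w /phi_sub1_inj <- bw; exists n.
Qed.

Lemma abelian_normal_finite : exists lA : list G, forall a, A a -> List.In a lA.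
Proof.
have [s sP] := simple_module_finite phiB phiK psiK cyclic_module_full.
exists (List.map (@abval _ _ _ _) s) => a Aa.
have := sP (AbelianSub sA cA Aa); elim: s {sP} => //= v s IHs.
by rewrite inE => /orP[/eqP <-|/IHs]; [left | right].
Qed.

(** The centralizer of [two_gen a1] is normal. If nontrivial, it contains a term of the lower
    central series, hence a nontrivial iterated commutator of [a1] with [y]; this one would be a
    fixed point of [y] in [A]. *)
Lemma centralizer_two_gen_trivial z :
  z ∗ y = y ∗ z -> z ∗ a1 = a1 ∗ z -> z = one.
Proof.
move=> zy za1; have /is_normalP[_ nK] := two_gen_normal Aa1 a11.
have Ez x : two_gen a1 x -> x ∗ z = z ∗ x.
  have yaC : subset_of (fun g => g = y \/ g = a1)
      (fun g => forall w, z = w -> w ∗ g = g ∗ w).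
    by move=> g [->|->] _ <-.
  by move/(gen_min (centralizer_subgroup _) yaC)/(_ z erefl)/esym.
apply: contrapT => z1; have [|n nE] := justG (centralizer_normal nK).
  by exists z.
have : exists c, [/\ A c, c <> one & lcs G (full G) n c].
  elim: n {nE} => [|k [c [Ac c1 ck]]]; first by exists a1.
  exists (comm G c y); split; last exact: commSub_in.
    by rewrite commE; apply: AM; [apply: AV | apply: AJ].
  by move/comm1P/(fixed_point_free Ac).
case=> c [Ac c1 /nE Ec]; apply: c1; apply: fixed_point_free => //.
by apply/conj_fixP/esym; apply: Ec; apply: gen_in; left.
Qed.

Lemma finite_of_central_modulo_centA : finite_group G.
Proof.
have conj_eq (x g h : G) : conj x g = conj x h -> g ∗ h⁻¹ ∗ x = x ∗ (g ∗ h⁻¹).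
  by move=> e; apply/esym/conj_fixP; rewrite conjMr e conjK.
have [lA lAP] := abelian_normal_finite.
(* Two elements of [Y] acting alike on [A] differ by one that commutes with both [y] and [a1]. *)
have [lY lYP] : exists lY : list G, forall u, Y u -> List.In u lY.
  apply: (finite_of_faithful_action lAP) => [h x _|u v Yu Yv uv]; first exact: AJ.
  apply: eq_mulV; apply: centralizer_two_gen_trivial.
    by apply/conj_fixP; apply: cycle_centralizes; apply: gen_mul => //; apply: gen_inv.
  by apply: conj_eq; apply: uv.
pose lK := List.flat_map (fun u => List.map (mul u) lA) lY.
have lKP z : two_gen a1 z -> List.In z lK.
  case/(@two_gen_decomposition (AbelianSub sA cA Aa1)) => u [v [Yu _ ->]].
  apply/List.in_flat_map; exists u; split; first exact: lYP.
  by apply: List.in_map; apply: lAP; apply: abvalP.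
have /is_normalP[_ nK] := two_gen_normal Aa1 a11.
have [|l lP] := @finite_of_faithful_action G (full G) _ _ lKP nK.
  move=> u v _ _ uv; apply: eq_mulV.
  by apply: centralizer_two_gen_trivial; apply: conj_eq; apply: uv;
     apply: gen_in; [left | right].
by exists l => q; apply: lP.
Qed.

End AbelianNormal.

Lemma just_non_nilpotent_finite : soluble_by_finite G -> finite_group G.
Proof.
case=> S [nS [[n tn] [l lP]]].
(* If [S] is trivial, its coset representatives exhaust [G]; otherwise the descent stops at the last
   nontrivial derived term, which is abelian. *)
elim: n tn => [|n IHn] tn.
  exists l => x; have [g [s [lg [/tn -> ->]]]] := lP x.
  by rewrite gmulg1.
have [/IHn //|nt] := pselect (trivial_sub G (der G S n)).
have [a [Aa a1]] : exists a, der G S n a /\ a <> one.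
  apply: contrapT => no; apply: nt => a Aa.
  by apply: contrapT => a1; apply: no; exists a.
have nA := der_normal n nS.
have cA u v : der G S n u -> der G S n v -> u ∗ v = v ∗ u.
  move=> Au Av; have /tn : der G S n.+1 (comm G u v) by apply: commSub_in.
  by move/comm1P/conj_fixP.
have [y [Dy Dyh]] := exists_central_modulo_centA nA cA Aa a1.
exact: (finite_of_central_modulo_centA nA cA Aa a1 Dy Dyh).
Qed.

End JustNonNilpotent.

(** * Reduction to a just-non-nilpotent quotient *)

Theorem mainTheorem2 (G : Group) :
  meta_Nil_Hamiltonian G -> soluble_by_finite G -> W_group G.
Proof.
move=> mG sbfG l nnH; set H := fin_gen G l in nnH *.
have sH : is_subgroup G H by apply: gen_subgroup.
have [N [[sN NH nN nnN] Nmax]] := non_nilpotent_modulo_maximal nnH.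
pose Q := quotient_group sH sN nN; pose f : G -> Q := quotient_proj sH sN nN.
have fP : hom_onto G H Q f by apply: quotient_proj_onto.
have kerf x : H x -> (f x = one <-> N x) by apply: quotient_proj_ker.
have nnQ : ~ nilpotent Q (full Q).
  case=> n tn; apply: (nnN n) => x xn; have Hx := lcs_sub sH xn.
  by apply/kerf => //; apply: tn; apply: hom_lcs fP _ _ xn.
exists Q, f; split; last by split.
apply: just_non_nilpotent_finite => //.
- exact: meta_Nil_Hamiltonian_image fP mG.
(* The preimage of [M] properly contains [N], so by maximality it contains a term of the lower
   central series of [H], whose image covers the corresponding term of [Q]. *)
- move=> M /is_normalP[sM nM] [q [Mq q1]].
  have [x [Hx xq]] := fP.2 q.
  have [|||||n nH] := Nmax (preimg H f M).
  + exact: preimg_subgroup fP _ sM.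
  + by move=> z [].
  + move=> h z Hh [Hz Mz]; split; first exact: conj_mem.
    by rewrite (hom_conj sH fP) //; apply: nM.
  + move=> z Nz; split; first exact: NH.
    by rewrite (kerf z (NH z Nz)).2 //; case: sM.
  + move=> /(_ x) MN; apply: q1; rewrite -xq; apply/kerf => //.
    by apply: MN; split=> //; rewrite xq.
  have fullH : subset_of (full Q) (img f H).
    by move=> q' _; have [z [Hz <-]] := fP.2 q'; exists z.
  exists n => q' /(img_lcs sH fP sH (fun _ => id) fullH)[z [/nH[_ Mz] <-]] //.
- exact: soluble_by_finite_image fP sbfG.
Qed.
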